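(* For every $\varepsilon>0$ there is $n_0(\varepsilon)$ such that for every $n>n_0(\varepsilon)$ the following holds. If $\mathcal A$ is a finite intersecting $n$-uniform family with $\tau(\mathcal A)\ge n/2$, then $$c_n(\mathcal A)\le \exp\!\left(-\left(\tau(\mathcal A)-\tfrac n2\right)n^{-0.5-\varepsilon}\right).$$
   Context: A family is intersecting if any two members intersect, and $n$-uniform if all members have exactly $n$ elements. A cover of a family $\mathcal A$ is a set meeting every member of $\mathcal A$; $\tau(\mathcal A)$ is the minimum size of a cover. A minimal cover is a cover none of whose proper subsets is a cover. With $n$ fixed, $\mathcal C(\mathcal A)$ denotes the family of all minimal covers $C$ of $\mathcal A$ with $|C|\le n$, and for $\lambda>0$, $c_\lambda(\mathcal A)=\sum_{C\in\mathcal C(\mathcal A)}\lambda^{-|C|}$. *)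

(* Defs.v *)
From mathcomp Require Import all_boot all_order all_algebra.
From mathcomp Require Import finmap.
From mathcomp Require Import all_classical all_reals all_analysis.

Set Implicit Arguments.
Unset Strict Implicit.
Unset Printing Implicit Defensive.

Import Order.TTheory GRing.Theory Num.Theory.

Local Open Scope fset_scope.

(* A finite family of finite sets is an [A : {fset {fset K}}]; the ground type
   [K] is an arbitrary, possibly infinite, [choiceType]. *)

Definition intersecting (K : choiceType) (A : {fset {fset K}}) : Prop :=
  forall a b : {fset K}, a \in A -> b \in A -> a `&` b != fset0.

Definition nuniform (K : choiceType) (n : nat) (A : {fset {fset K}}) : Prop :=
  forall a : {fset K}, a \in A -> #|` a| = n.

Definition is_cover (K : choiceType) (A : {fset {fset K}}) (C : {fset K}) :
  bool := all (fun a : {fset K} => C `&` a != fset0) (enum_fset A).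

Definition is_min_cover (K : choiceType) (A : {fset {fset K}})
  (C : {fset K}) : bool :=
  is_cover A C &&
  all (fun B : {fset K} => (B `<` C) ==> ~~ is_cover A B)
      (enum_fset (fpowerset C)).

Definition ground (K : choiceType) (A : {fset {fset K}}) : {fset K} :=
  \bigcup_(a <- A) a.

(* Restricting to subsets of [ground A] loses nothing, see [tau_le] and
   [tau_attained]. If [fset0 \in A], so that no cover exists, the value is the
   irrelevant [#|` ground A|]. *)
Definition tau (K : choiceType) (A : {fset {fset K}}) : nat :=
  \big[minn/#|` ground A|]_(C <- fpowerset (ground A) | is_cover A C) #|` C|.

(* The minimal covers with at most [n] elements; they all are subsets of
   [ground A], see [in_min_covers]. *)
Definition min_covers (K : choiceType) (n : nat) (A : {fset {fset K}}) :
  {fset {fset K}} :=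
  [fset C in fpowerset (ground A) | is_min_cover A C && (#|` C| <= n)%N].

Definition cweight (R : realType) (K : choiceType) (n : nat) (lambda : R)
  (A : {fset {fset K}}) : R :=
  (\sum_(C <- min_covers n A) lambda ^- #|` C|)%R.

Lemma is_coverP (K : choiceType) (A : {fset {fset K}}) (C : {fset K}) :
  reflect (forall a : {fset K}, a \in A -> C `&` a != fset0) (is_cover A C).
Proof. exact: allP. Qed.

Lemma is_min_coverP (K : choiceType) (A : {fset {fset K}}) (C : {fset K}) :
  reflect (is_cover A C /\
           forall B : {fset K}, B `<` C -> ~~ is_cover A B)
          (is_min_cover A C).
Proof.
apply: (iffP andP) => -[covC minC]; split=> //.
  move=> B BC; have := allP minC B; rewrite fpowersetE (fproper_sub BC).
  by move=> /(_ isT) /implyP; apply.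
by apply/allP => B _; apply/implyP; apply: minC.
Qed.

Lemma is_coverI_ground (K : choiceType) (A : {fset {fset K}}) (C : {fset K}) :
  is_cover A C -> is_cover A (C `&` ground A).
Proof.
move=> /is_coverP covC; apply/is_coverP => a aA.
have /fsetIidPr aS : a `<=` ground A by apply: (@bigfcup_sup _ _ _ a _ id).
by rewrite -fsetIA aS covC.
Qed.

Lemma in_min_covers (K : choiceType) (n : nat) (A : {fset {fset K}})
    (C : {fset K}) :
  (C \in min_covers n A) = is_min_cover A C && (#|` C| <= n)%N.
Proof.
rewrite !inE /= fpowersetE andbC; case: (boolP (is_min_cover A C)) => //=.
move=> /is_min_coverP[covC minC]; suff -> : C `<=` ground A by rewrite andbT.
apply: contraT => CS; have /minC := fproperIr CS.
by rewrite fsetIC is_coverI_ground.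
Qed.

Lemma tau_le (K : choiceType) (A : {fset {fset K}}) (C : {fset K}) :
  is_cover A C -> (tau A <= #|` C|)%N.
Proof.
move=> covC; apply: (@leq_trans #|` C `&` ground A|); last first.
  by rewrite fsubset_leq_card // fsubsetIl.
have : C `&` ground A \in enum_fset (fpowerset (ground A)).
  by rewrite fpowersetE fsubsetIr.
rewrite /tau; elim: enum_fset => // D s IHs; rewrite inE big_cons.
case/predU1P => [<-|/IHs le_s]; first by rewrite is_coverI_ground // geq_minl.
by case: ifP => // _; rewrite (leq_trans (geq_minr _ _)).
Qed.

Lemma tau_attained (K : choiceType) (A : {fset {fset K}}) :
  (forall a : {fset K}, a \in A -> a != fset0) ->
  exists2 C : {fset K}, is_cover A C & #|` C| = tau A.
Proof.
move=> A0; rewrite /tau; elim/big_ind: _ => [|m p [C cC <-] [D cD <-]|C cC].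
- exists (ground A) => //; apply/is_coverP => a aA.
  have /fsetIidPr -> : a `<=` ground A by apply: (@bigfcup_sup _ _ _ a _ id).
  exact: A0.
- by case: (leqP #|` C| #|` D|) => h; [exists C | exists D].
- by exists C.
Qed.

(* Main.v *)
Require Import Defs.
From mathcomp Require Import all_boot all_order all_algebra.
From mathcomp Require Import finmap.
From mathcomp Require Import all_classical all_reals all_analysis.
From mathcomp Require Import zify ring lra.
Set Implicit Arguments.
Unset Strict Implicit.
Unset Printing Implicit Defensive.
Import Order.TTheory GRing.Theory Num.Theory.
Local Open Scope ring_scope.

(** Fix [delta] of order at most [n ^ (-1/2)], and let [beta A] be the right-hand
    side. Every minimal cover of [A] either contains one of the points of a
    given set [U] or avoids [U]; hence, if [T] lists members of [A] which meet
    pairwise only inside [U], branching gives [cweight A <= beta A] by induction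
    as soon as
      [#|U| / n * e^delta + \prod_(b in T) (#|b \ U| / n * e^delta) <= 1],
    because deleting the members through one point lowers [tau] by at most 1.
    If two members [a], [b] have [k <= #|a & b| <= n - k] with [k] of order
    [sqrt n], then [T = a, b] and [U = a & b] will do. Otherwise grow [T]
    greedily, [U] being the set of points of degree two: while [U] is smaller
    than a multiple of [n], it and [k] points of each member of [T] together
    do not form a cover, so some member [a] avoids them. Then [a] is far from
    all of [T], so it meets each member of [T] in fewer than [k] points, but in
    at least one, and these points are distinct. Thus [#|U|] is quadratic in
    [size T], while each point of [U] is counted twice in the product, and the
    displayed inequality holds before [T] has more than [k] members. *)

(** * Deleting the members through a point *)

Definition avoiding (K : choiceType) (A : {fset {fset K}}) (x : K) :
  {fset {fset K}} := [fset a in A | x \notin a]%fset.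

Definition cweight_off (R : realType) (K : choiceType) (n : nat) (lambda : R)
    (A : {fset {fset K}}) (U : {fset K}) : R :=
  \sum_(C <- min_covers n A | [disjoint C & U]%fset) lambda ^- #|` C|.

Section Covers.
Variable K : choiceType.
Implicit Types (A : {fset {fset K}}) (a b B C U W X : {fset K}) (x : K).
Local Open Scope fset_scope.

Lemma in_avoiding A x a : (a \in avoiding A x) = (a \in A) && (x \notin a).
Proof. by rewrite !inE. Qed.

Lemma avoiding_sub A x : avoiding A x `<=` A.
Proof. exact: fset_sub. Qed.

Lemma avoiding_proper A a x : a \in A -> x \in a -> avoiding A x `<` A.
Proof.
move=> aA xa; rewrite fproperEneq avoiding_sub andbT.
by apply/eqP => E; move: aA; rewrite -E in_avoiding xa andbF.
Qed.

Lemma intersecting_sub A A' :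
  A' `<=` A -> intersecting A -> intersecting A'.
Proof. by move=> /fsubsetP sA h a b /sA aA /sA bA; apply: h. Qed.

Lemma nuniform_sub n A A' : A' `<=` A -> nuniform n A -> nuniform n A'.
Proof. by move=> /fsubsetP sA h a /sA; apply: h. Qed.

Lemma coverD1 A C x : is_cover A C -> is_cover (avoiding A x) (C `\ x).
Proof.
move=> /is_coverP h; apply/is_coverP => a; rewrite in_avoiding => /andP[aA xa].
have /fset0Pn[y] := h _ aA; rewrite inE => /andP[yC ya].
apply/fset0Pn; exists y; rewrite !inE yC ya !andbT.
by apply: contraNneq xa => <-.
Qed.

Lemma coverU1 A C x : is_cover (avoiding A x) C -> is_cover A (x |` C).
Proof.
move=> /is_coverP h; apply/is_coverP => a aA; apply/fset0Pn.
have [xa|xa] := boolP (x \in a); first by exists x; rewrite !inE eqxx.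
have /h/fset0Pn[y] : a \in avoiding A x by rewrite in_avoiding aA.
by rewrite inE => /andP[yC ya]; exists y; rewrite !inE yC ya orbT.
Qed.

(** Adding [x] to a cover of [avoiding A x] gives a cover of [A], so a smaller cover inside [C]
    minus [x] would contradict the minimality of [C]. *)
Lemma min_coversD1 n A C x :
  C \in min_covers n A -> x \in C -> C `\ x \in min_covers n (avoiding A x).
Proof.
rewrite !in_min_covers => /andP[/is_min_coverP[covC minC] leC] xC.
apply/andP; split; last first.
  by rewrite (leq_trans _ leC)// fsubset_leq_card// fsubD1set.
apply/is_min_coverP; split=> [|B BC]; first exact: coverD1.
have /minC : x |` B `<` C.
  rewrite fproperEneq; apply/andP; split; last first.
    rewrite fsubUset fsub1set xC; apply: fsubset_trans (fproper_sub BC) _.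
    by rewrite fsubD1set.
  apply/eqP => E; have xB : x \notin B.
    by apply/negP => /(fsubsetP (fproper_sub BC)); rewrite !inE eqxx.
  by move: BC; rewrite -E fsetU1K // fproperEneq eqxx.
by apply: contra => /coverU1.
Qed.

(** Adding [x] to an optimal cover of [avoiding A x] costs at most one point; non-empty members
    ensure that the minimum is attained. *)
Lemma tau_avoiding A x :
  (forall a, a \in A -> a != fset0) -> (tau A <= (tau (avoiding A x)).+1)%N.
Proof.
move=> A0; have [|C covC <-] := @tau_attained K (avoiding A x).
  by move=> a; rewrite in_avoiding => /andP[/A0].
apply: leq_trans (tau_le (coverU1 covC)) _.
by rewrite cardfsU1 -add1n leq_add2r; case: (_ \notin _).
Qed.

Lemma exists_disjoint_member A X :
  (#|` X| < tau A)%N -> exists2 a, a \in A & X `&` a = fset0.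
Proof.
move=> ltX; have : ~~ is_cover A X.
  by apply: contraL ltX => /tau_le; rewrite -leqNgt.
by case/allPn => a aA; rewrite negbK => /eqP ?; exists a.
Qed.

End Covers.

(** * Branching inequalities for cover weights *)

Section Weights.
Variables (R : realType) (K : choiceType).
Implicit Types (A : {fset {fset K}}) (a b B C U W X : {fset K}) (x : K).

Lemma ler_sum_fsubset (I : choiceType) (s t : {fset I}) (F : I -> R) :
  (s `<=` t)%fset -> (forall i, 0 <= F i) ->
  \sum_(i <- s) F i <= \sum_(i <- t) F i.
Proof.
move=> st F0; rewrite [leRHS](big_fsetID _ (mem s)) /=.
have -> : [fset i in t | i \in s]%fset = s.
  apply/fsetP => i; rewrite !inE /= andbC.
  by case: (boolP (i \in s)) => // /(fsubsetP st) ->.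
by rewrite lerDl sumr_ge0.
Qed.

Lemma cweight_off0 n (lambda : R) A :
  cweight_off n lambda A fset0 = cweight n lambda A.
Proof. by apply: eq_bigl => C; rewrite fdisjointX0. Qed.

Variables (n : nat) (lambda : R).
Hypothesis lambda_gt0 : 0 < lambda.

Lemma cweight_off_le A U : cweight_off n lambda A U <= cweight n lambda A.
Proof.
rewrite /cweight_off big_mkcond; apply: ler_sum => C _.
by case: ifP => // _; rewrite invr_ge0 exprn_ge0 // ltW.
Qed.

(** Removing [x] is injective on the covers through [x], leaves minimal covers of [avoiding A x],
    and multiplies the weight by [lambda]. *)
Lemma sum_min_covers_mem A U x :
  \sum_(C <- min_covers n A | [disjoint C & U]%fset && (x \in C))
     lambda ^- #|` C|
  <= lambda^-1 * cweight_off n lambda (avoiding A x) U.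
Proof.
set S := [fset C in min_covers n A | [disjoint C & U]%fset && (x \in C)]%fset.
set S' := [fset C in min_covers n (avoiding A x) | [disjoint C & U]%fset]%fset.
have -> : cweight_off n lambda (avoiding A x) U = \sum_(D <- S') lambda ^- #|` D|.
  by rewrite /cweight_off big_fset_condE.
rewrite big_fset_condE -/S.
have inS (T : {fset {fset K}}) (P : pred {fset K}) D :
  (D \in [fset C in T | P C]%fset) = (D \in T) && P D by rewrite !inE.
have memS C : C \in S -> x \in C by rewrite inS => /and3P[].
have -> : \sum_(C <- S) lambda ^- #|` C| =
    lambda^-1 * \sum_(C <- S) lambda ^- #|` (C `\ x)%fset|.
  rewrite big_distrr /= big_seq [RHS]big_seq; apply: eq_bigr => C /memS xC.
  by rewrite (cardfsD1 x C) xC add1n exprS invfM.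
rewrite ler_pM2l ?invr_gt0 //.
have <- : \sum_(D <- [fset (C `\ x)%fset | C in S]%fset) lambda ^- #|` D| =
    \sum_(C <- S) lambda ^- #|` (C `\ x)%fset|.
  rewrite big_imfset //= => C D /memS xC /memS xD E.
  by rewrite -(fsetD1K xC) E fsetD1K.
apply: ler_sum_fsubset => [|D]; last by rewrite invr_ge0 exprn_ge0 // ltW.
apply/fsubsetP => _ /imfsetP[C /= CS ->].
move: CS; rewrite inS => /and3P[CA CU xC]; rewrite inS.
apply/andP; split; first exact: min_coversD1.
by apply: fdisjointWl CU; rewrite fsubD1set.
Qed.

(** A union bound over [W]: a cover with several points in [W] is counted once for each of them. *)
Lemma branching A U W :
  \sum_(C <- min_covers n A | [disjoint C & U]%fset && (C `&` W != fset0)%fset)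
     lambda ^- #|` C|
  <= \sum_(x <- W) lambda^-1 * cweight_off n lambda (avoiding A x) U.
Proof.
apply: le_trans (ler_sum _ (fun x _ => sum_min_covers_mem A U x)).
under [leRHS]eq_bigr do rewrite big_mkcond.
rewrite exchange_big /= big_mkcond /=; apply: ler_sum => C _.
have w0 : 0 <= lambda ^- #|` C| by rewrite invr_ge0 exprn_ge0 // ltW.
case: ifP => [/andP[-> /fset0Pn[x]]|_]; last first.
  by apply: sumr_ge0 => x _; case: ifP.
rewrite inE => /andP[xC xW]; rewrite (big_rem x xW) /= xC lerDl.
by apply: sumr_ge0 => y _; case: ifP.
Qed.

Lemma cweight_off_branch A U b : b \in A ->
  cweight_off n lambda A U
  <= \sum_(x <- (b `\` U)%fset) lambda^-1 * cweight_off n lambda (avoiding A x) U.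
Proof.
move=> bA; apply: le_trans (branching A U (b `\` U)%fset).
rewrite /cweight_off big_seq_cond [leRHS]big_seq_cond le_eqVlt; apply/orP; left.
apply/eqP; apply: eq_bigl => C; rewrite in_min_covers.
case: is_min_coverP => //= -[/is_coverP/(_ _ bA)/fset0Pn[x]].
rewrite inE => /andP[xC xb] _; case: (boolP [disjoint C & U]%fset) => //= CU.
congr (_ && _); apply/esym/fset0Pn; exists x.
by rewrite !inE xC xb andbT; apply: (fdisjointP CU).
Qed.

Lemma cweight_split A U :
  cweight n lambda A <=
  \sum_(x <- U) lambda^-1 * cweight n lambda (avoiding A x)
  + cweight_off n lambda A U.
Proof.
rewrite /cweight (bigID (fun C => (C `&` U != fset0)%fset)) /=; apply: lerD.
  under [leRHS]eq_bigr do rewrite -/(cweight _ _ _) -cweight_off0.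
  apply: le_trans (branching A fset0 U); rewrite le_eqVlt; apply/orP; left.
  by apply/eqP; apply: eq_bigl => C; rewrite fdisjointX0.
rewrite le_eqVlt; apply/orP; left; apply/eqP; apply: eq_bigl => C.
by rewrite negbK fsetI_eq0.
Qed.

End Weights.

(** This is [beta] of the overview, with [delta] standing for the power of [n]. *)
Definition tau_bound (R : realType) (K : choiceType) (n : nat) (delta : R)
  (A : {fset {fset K}}) : R := expR (- (((tau A)%:R - n%:R / 2) * delta)).

(** * The recursion: from proper subfamilies to the whole family *)

Section Recursion.
Variables (R : realType) (K : choiceType) (n : nat).
Implicit Types (A : {fset {fset K}}) (a b B C U W X : {fset K}) (x : K).
Hypothesis n_gt0 : (0 < n)%N.

Let nR_gt0 : 0 < n%:R :> R. Proof. by rewrite ltr0n. Qed.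

Lemma fproper_ind (P : {fset {fset K}} -> Prop) :
  (forall A, (forall A', (A' `<` A)%fset -> P A') -> P A) -> forall A, P A.
Proof.
move=> H A; have [m] := ubnP #|` A|; elim: m A => // m IH A leA.
by apply: H => A' /fproper_ltn_card lt; apply: IH; apply: leq_trans lt leA.
Qed.

Lemma sumr_const_fset U (c : R) : \sum_(x <- U) c = #|` U|%:R * c.
Proof. by rewrite big_const_seq count_predT iter_addr addr0 mulr_natl. Qed.

Lemma cweight_fset0 : cweight n (n%:R : R) (fset0 : {fset {fset K}}) <= 1.
Proof.
apply: (@le_trans _ _ (\sum_(C <- [fset fset0 : {fset K}]%fset) n%:R ^- #|` C|)).
  apply: ler_sum_fsubset => [|C]; last by rewrite invr_ge0 exprn_ge0.
  apply/fsubsetP => C; rewrite in_min_covers => /andP[/is_min_coverP[_ minC] _].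
  rewrite in_fset1; apply: contraT; rewrite -fproper0 => /minC /is_coverP.
  by case=> a; rewrite in_fset0.
by rewrite big_seq_fset1 cardfs0 expr0 invr1.
Qed.

(** Branching on one member gives [n] points, each contributing at most [1 / n]. This settles the
    families with [tau A < n / 2]. *)
Lemma cweight_le1 A : nuniform n A -> cweight n (n%:R : R) A <= 1.
Proof.
elim/fproper_ind: A => A IH uA.
have [->|[b bA]] := fset_0Vmem A; first exact: cweight_fset0.
rewrite -cweight_off0; apply: (le_trans (cweight_off_branch n nR_gt0 fset0 bA)).
rewrite fsetD0; apply: (@le_trans _ _ (\sum_(x <- b) n%:R^-1)).
  rewrite big_seq [leRHS]big_seq; apply: ler_sum => x xb.
  rewrite ler_piMr ?invr_ge0 // cweight_off0; apply: IH.
    exact: avoiding_proper bA xb.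
  exact: nuniform_sub (avoiding_sub A x) uA.
by rewrite sumr_const_fset (uA _ bA) divff // gt_eqF.
Qed.

Variable delta : R.
Hypothesis delta_ge0 : 0 <= delta.

Lemma tau_bound_avoiding A x : nuniform n A ->
  tau_bound n delta (avoiding A x) <= tau_bound n delta A * expR delta.
Proof.
move=> uA; rewrite -expRD ler_expR.
have /(tau_avoiding x) : forall a, a \in A -> a != fset0.
  by move=> a /uA ua; rewrite -cardfs_gt0 ua.
rewrite -(ler_nat R) -natr1 => t; rewrite -subr_ge0.
have -> : - (((tau A)%:R - n%:R / 2) * delta) + delta
  - - (((tau (avoiding A x))%:R - n%:R / 2) * delta)
  = ((tau (avoiding A x))%:R + 1 - (tau A)%:R) * delta :> R by ring.
by rewrite mulr_ge0 // subr_ge0.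
Qed.

(** Branching on the listed members in turn, each factor pays for the choice of a point outside [U]
    and for the possible drop of [tau]. Keeping [b] apart makes the list non-empty, so a deletion
    takes place before [bnd] is invoked. *)
Lemma cweight_off_prod A (b : {fset K}) (T : seq {fset K}) U :
  nuniform n A ->
  (forall A', (A' `<` A)%fset -> cweight n n%:R A' <= tau_bound n delta A') ->
  {subset b :: T <= A} ->
  pairwise (fun a b => (a `&` b `<=` U)%fset) (b :: T) ->
  cweight_off n n%:R A U <=
  tau_bound n delta A *
    \prod_(c <- b :: T) (#|` (c `\` U)%fset|%:R / n%:R * expR delta).
Proof.
elim: T b A => [|c T IH] b A uA bnd TA; rewrite pairwise_cons => /andP[bT pT];
  have bA : b \in A by apply: TA; rewrite inE eqxx.
all: apply: le_trans (cweight_off_branch n nR_gt0 U bA) _.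
all: rewrite big_cons; set P := \big[_/_]_(_ <- _) _.
all: have P0 : 0 <= P
  by apply: prodr_ge0 => d _; rewrite mulr_ge0 ?expR_ge0 // divr_ge0.
all: have -> : tau_bound n delta A * (#|` (b `\` U)%fset|%:R / n%:R * expR delta * P)
  = \sum_(x <- (b `\` U)%fset) n%:R^-1 * (tau_bound n delta A * expR delta * P)
  by rewrite sumr_const_fset; ring.
all: rewrite big_seq [leRHS]big_seq; apply: ler_sum => x.
all: rewrite inE => /andP[xU xb]; rewrite ler_pM2l ?invr_gt0 //.
all: apply: le_trans (ler_wpM2r P0 (tau_bound_avoiding x uA)).
all: have sA := avoiding_proper bA xb.
  (* At the last member the restriction to covers off [U] is dropped and [bnd] takes over. *)
  rewrite /P big_nil mulr1; apply: le_trans (bnd _ sA).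
  exact: cweight_off_le.
apply: IH pT.
- exact: nuniform_sub (fproper_sub sA) uA.
- by move=> A' sA'; apply: bnd; apply: fproper_sub_trans sA' (avoiding_sub A x).
(* The point [x] of [b] lies outside [U], which contains the overlap of [b] and [d]; hence [d]
   survives the deletion. *)
- move=> d dT; rewrite in_avoiding TA ?[_ \in b :: _]inE ?dT ?orbT //=.
  apply: contra xU => xd; apply: (fsubsetP (allP bT _ dT)).
  by rewrite inE xb xd.
Qed.

(** Covers meeting [U] account for the first summand, the others for the product. Points of [U] lie
    in [ground A], so deleting the members through them leaves a proper subfamily. *)
Lemma cweight_le_tau_bound_step A (b : {fset K}) (T : seq {fset K}) U :
  nuniform n A ->
  (forall A', (A' `<` A)%fset -> cweight n n%:R A' <= tau_bound n delta A') ->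
  {subset b :: T <= A} -> (U `<=` ground A)%fset ->
  pairwise (fun a b => (a `&` b `<=` U)%fset) (b :: T) ->
  #|` U|%:R / n%:R * expR delta
    + \prod_(c <- b :: T) (#|` (c `\` U)%fset|%:R / n%:R * expR delta) <= 1 ->
  cweight n n%:R A <= tau_bound n delta A.
Proof.
move=> uA bnd TA /fsubsetP UA pT le1.
rewrite -[leRHS]mulr1.
apply: le_trans (ler_wpM2l (expR_ge0 _) le1).
rewrite mulrDr; apply: le_trans (cweight_split n nR_gt0 A U) _; apply: lerD; last first.
  exact: cweight_off_prod.
have -> : expR (- (((tau A)%:R - n%:R / 2) * delta)) *
    (#|` U|%:R / n%:R * expR delta)
  = \sum_(x <- U) n%:R^-1 * (tau_bound n delta A * expR delta).
  by rewrite sumr_const_fset /tau_bound; ring.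
rewrite big_seq [leRHS]big_seq; apply: ler_sum => x /UA /bigfcupP[a].
rewrite andbT => aA xa.
rewrite ler_pM2l ?invr_gt0 //; apply: le_trans (tau_bound_avoiding x uA).
exact/bnd/(avoiding_proper aA xa).
Qed.

End Recursion.

(** * Growing a chain of members with controlled overlaps *)

Section Chain.
Variable K : choiceType.
Implicit Types (A : {fset {fset K}}) (a b B C U W X : {fset K}) (x : K).
Local Open Scope fset_scope.
Local Open Scope nat_scope.

Lemma leq_card_bigfcup (T : seq {fset K}) (F : {fset K} -> {fset K}) :
  #|` \bigcup_(b <- T) F b| <= \sum_(b <- T) #|` F b|.
Proof.
elim: T => [|b T IH]; first by rewrite !big_nil cardfs0.
rewrite !big_cons; apply: leq_trans (leq_card_fsetU _ _) _.
by rewrite leq_add2l.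
Qed.

Lemma card_bigfcup_disjoint (T : seq {fset K}) (F : {fset K} -> {fset K}) :
  pairwise (fun b c => [disjoint F b & F c]) T ->
  #|` \bigcup_(b <- T) F b| = \sum_(b <- T) #|` F b|.
Proof.
elim: T => [|b T IH]; first by rewrite !big_nil cardfs0.
rewrite pairwise_cons !big_cons => /andP[/allP bT /IH <-].
apply/eqP; rewrite (leq_card_fsetU _ _); apply/fdisjointP => x xb.
apply/negP => /bigfcupP[c]; rewrite andbT => cT xc.
by have /fdisjointP/(_ _ xb) := bT _ cT; rewrite xc.
Qed.

Lemma sum_nat_seq_const (T : seq {fset K}) m :
  \sum_(b <- T) m = size T * m.
Proof. by rewrite big_const_seq count_predT iter_addn_0 mulnC. Qed.

Lemma exists_subset_card b m : m <= #|` b| -> exists2 Y, Y `<=` b & #|` Y| = m.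
Proof.
move=> le; exists [fset x in take m b].
  by apply/fsubsetP => x; rewrite !inE /= => /mem_take.
rewrite card_fseq undup_id ?take_uniq ?fset_uniq // size_take_min.
exact/minn_idPl.
Qed.

(* The last clause holds because each point of [U] has degree at least two. *)
Definition overlap_chain A (T : seq {fset K}) U : Prop :=
  [/\ {subset T <= A}, U `<=` ground A,
      pairwise (fun a b => a `&` b `<=` U) T
    & #|` U|.*2 <= \sum_(b <- T) #|` b `&` U|].

(** Since [a] misses [U], which contains all old overlaps, the traces of [a] on the members of [T]
    are disjoint from each other and from [U]. Each new point is counted once through [a] and once
    through an old member, which preserves the last clause. *)
Lemma overlap_chain_cons A T U a : a \in A -> a `&` U = fset0 ->
  overlap_chain A T U ->
  let N := \bigcup_(b <- T) (a `&` b) in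
  [/\ overlap_chain A (a :: T) (U `|` N), #|` U `|` N| = #|` U| + #|` N|
    & #|` N| = \sum_(b <- T) #|` a `&` b|].
Proof.
move=> aA aU [TA UA pT sT] N.
have aN x : x \in N -> x \in a.
  by case/bigfcupP => b _; rewrite inE => /andP[].
have aNU x : x \in a -> x \notin U.
  by move=> xa; apply/negP => xU; have := in_fset0 x; rewrite -aU inE xa xU.
have sub_ground b : b \in A -> b `<=` ground A.
  by move=> bA; apply: (@bigfcup_sup _ _ _ b _ id).
have abN b : b \in T -> a `&` b `<=` N.
  by move=> bT; apply: (@bigfcup_sup _ _ _ b _ (fun b => a `&` b)).
have cardUN : #|` U `|` N| = #|` U| + #|` N|.
  apply/eqP; rewrite (leq_card_fsetU _ _); apply/fdisjointP => x xU.
  by apply: contraL xU => /aN/aNU.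
have cardN : #|` N| = \sum_(b <- T) #|` a `&` b|.
  apply: card_bigfcup_disjoint; apply: sub_pairwise pT => b c /fsubsetP bcU.
  apply/fdisjointP => x; rewrite !inE => /andP[xa xb]; rewrite xa /=.
  by apply: contra (aNU _ xa) => xc; apply: bcU; rewrite inE xb.
split=> //; split.
- by move=> b; rewrite inE => /predU1P[->|/TA].
- rewrite fsubUset UA; apply/fsubsetP => x /aN.
  by apply/fsubsetP/sub_ground.
- rewrite pairwise_cons; apply/andP; split.
    by apply/allP => b /abN h; apply: fsubset_trans h (fsubsetUr _ _).
  by apply: sub_pairwise pT => b c h; apply: fsubset_trans h (fsubsetUl _ _).
- rewrite big_cons cardUN.
  have h1 : #|` N| <= #|` a `&` (U `|` N)|.
    apply: fsubset_leq_card; apply/fsubsetP => x xN.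
    by rewrite !inE aN // xN orbT.
  have h2 : \sum_(b <- T) #|` b `&` U| + #|` N| <=
      \sum_(b <- T) #|` b `&` (U `|` N)|.
    rewrite cardN -big_split /= big_seq [leqRHS]big_seq.
    apply: leq_sum => b bT.
    have /eqP <- : #|` (b `&` U) `|` (a `&` b)| == #|` b `&` U| + #|` a `&` b|.
      rewrite (leq_card_fsetU _ _); apply/fdisjointP => x; rewrite !inE.
      by move=> /andP[_ xU]; apply/negP => /andP[/aNU]; rewrite xU.
    apply: fsubset_leq_card; apply/fsubsetP => x; rewrite !inE.
    case/orP => [/andP[-> ->] //|/andP[xa xb]]; rewrite xb /=.
    by rewrite (fsubsetP (abN _ bT)) ?orbT // inE xa.
  lia.
Qed.

(** Growth stops once [2 |U|] reaches [k - 1] times the number of members. Each new member adds at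
    least one point per earlier one, so this happens by the time there are [k] members. *)
Lemma exists_overlap_chain n k A : intersecting A -> nuniform n A ->
  0 < k -> 6 * k ^ 2 <= n -> n <= (tau A).*2 ->
  (forall a b, a \in A -> b \in A -> #|` a `&` b| < k \/ n - k < #|` a `&` b|) ->
  exists b T U, [/\ overlap_chain A (b :: T) U, 4 * #|` U| <= n
    & (k.-1 * size (b :: T)) <= #|` U|.*2].
Proof.
move=> iA uA k_gt0 kn nt far.
have tau_gt0 : 0 < tau A by nia.
have [b0 b0A _] : exists2 a, a \in A & fset0 `&` a = fset0.
  by apply: exists_disjoint_member; rewrite cardfs0.
apply: contrapT => none.
(* At [j = k - 1] the lower and the upper bound on [2 |U|] collide. *)
suff H j : j < k -> exists b T U, [/\ overlap_chain A (b :: T) U, size T = j,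
    j * j.+1 <= #|` U|.*2 & #|` U|.*2 < k.-1 * j.+1].
  have /H[b [T [U [_ _ h1 h2]]]] : k.-1 < k by rewrite prednK.
  by move: (leq_ltn_trans h1 h2); rewrite ltnn.
elim: j => [_|j IH ltjk].
  have ch : overlap_chain A [:: b0] fset0.
    split; rewrite ?cardfs0 //; first by move=> b; rewrite inE => /eqP ->.
  exists b0, [::], fset0; split; rewrite ?cardfs0 // ltnNge.
  by apply/negP => h; apply: none; exists b0, [::], fset0; rewrite cardfs0.
have [b [T0 [U [ch sT0 lo hi]]]] := IH (ltnW ltjk).
move: ch sT0; set T := b :: T0 => ch sT0.
have sT : size T = j.+1 by rewrite /= sT0.
have [TA UA pT sumT] := ch.
pose P (c Y : {fset K}) := (Y `<=` c) && (#|` Y| == k).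
have /choice[Y YP] : forall c : {fset K}, exists Z : {fset K}, c \in A -> P c Z.
  move=> c; case: (boolP (c \in A)) => [cA|]; last by exists fset0.
  have [|Z sZ cZ] := @exists_subset_card c k; first by rewrite (uA _ cA); nia.
  by exists Z; rewrite /P sZ cZ eqxx.
pose X := U `|` \bigcup_(c <- T) Y c.
have cX : #|` X| <= #|` U| + j.+1 * k.
  apply: leq_trans (leq_card_fsetU _ _) _; rewrite leq_add2l.
  apply: leq_trans (leq_card_bigfcup _ _) _.
  rewrite -sT -sum_nat_seq_const big_seq [leqRHS]big_seq.
  by apply: leq_sum => c /TA/YP/andP[_ /eqP ->].
(* From [2 |U| < (k - 1)(j + 1)] and [j + 1 < k] follows [2 |X| < 3 k ^ 2 <= n <= 2 tau A], so [X]
   is not a cover. *)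
have [|a aA Xa] := @exists_disjoint_member _ A X; first by nia.
have aX x : x \in a -> x \notin X.
  by move=> xa; apply/negP => xX; have := in_fset0 x; rewrite -Xa inE xa xX.
have aU : a `&` U = fset0.
  apply/eqP; rewrite fsetI_eq0; apply/fdisjointP => x /aX.
  by rewrite inE negb_or => /andP[].
have [] := overlap_chain_cons aA aU ch.
set N := \bigcup_(_ <- _) _ => ch' cardUN cardN.
have loN : j.+1 <= #|` N|.
  rewrite cardN -[j.+1]muln1 -sT -sum_nat_seq_const big_seq [leqRHS]big_seq.
  by apply: leq_sum => c cT; rewrite cardfs_gt0 iA // TA.
have hiN : #|` N| <= j.+1 * k.-1.
  rewrite cardN -sT -sum_nat_seq_const big_seq [leqRHS]big_seq.
  apply: leq_sum => c cT; have cA := TA _ cT.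
  have /andP[sY /eqP cY] := YP _ cA.
  (* Missing the [k] points [Y c] of [c], the member [a] shares at most [n - k] points with [c], so
     only the small alternative of [far] remains. *)
  have [|] := far a c aA cA; first by lia.
  have : #|` a `&` c| <= #|` c `\` Y c|.
    apply: fsubset_leq_card; apply/fsubsetP => x; rewrite !inE => /andP[xa ->].
    rewrite andbT; apply: contra (aX _ xa) => xY; rewrite inE; apply/orP; right.
    by apply/bigfcupP; exists c; rewrite ?cT.
  by rewrite cardfsDS // (uA _ cA) cY; lia.
exists a, T, (U `|` N); split=> //; first by nia.
(* Otherwise the new chain contradicts [none]: its size condition holds because [|U|] and [|N|] are
   at most [(k - 1)(j + 1) / 2] and [(k - 1)(j + 1)], so four times their sum is at most [6 k ^ 2].
   This is the source of the 6. *)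
rewrite ltnNge; apply/negP => h; apply: none; exists a, T, (U `|` N); split=> //.
  by nia.
by rewrite /= sT0.
Qed.

End Chain.

(** * Numerical inequalities for the two cases *)

Section Estimates.
Variable R : realType.
Implicit Types p q mu d j E : R.

(** Combine [(1 - x) e^x <= 1] with [(1 - x)(1 + 2 x) >= 1], which holds up to [x = 1 / 2]. *)
Lemma expR_le1D2x (x : R) : 0 <= x <= 1 / 2 -> expR x <= 1 + 2 * x.
Proof.
move=> x01; have := expR_ge1Dx (- x); rewrite expRN => h.
have E0 := expR_gt0 x.
have : (1 - x) * expR x <= 1.
  by apply: le_trans (ler_wpM2r (ltW E0) h) _; rewrite mulVf ?gt_eqF.
nra.
Qed.

(* With [s := 1 - p], the product [s * (1 - s)] is at least [mu * (1 - mu)]. *)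
Lemma pair_estimate p mu E :
  mu <= 1 / 4 -> mu <= p <= 1 - mu -> 1 <= E <= 1 + mu / 4 ->
  p * E + ((1 - p) * E) * ((1 - p) * E) <= 1.
Proof.
move=> mu4 /andP[mup pmu] /andP[E1 Emu].
have s1 : mu * (1 - mu) <= (1 - p) * p by nra.
have s2 : (1 - p) ^+ 2 <= 1 by nra.
have s3 : (1 - p) ^+ 2 * (E - 1) <= mu / 4 by nra.
have s4 : mu / 4 <= (1 - p) * p - (1 - p) ^+ 2 * (E - 1) by nra.
nra.
Qed.

(** Here [q] is [|U| / n]. The double count gives [2 q] in the exponent, of which [j d] takes away
    at most [q / 4]; the remaining [7 / 4 * q] beats the first summand. *)
Lemma chain_estimate q d j E : 0 <= q <= 1 / 4 -> E <= 1 + 2 * d ->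
  4 * d <= q -> 4 * (j * d) <= q -> q * E + expR (j * d - 2 * q) <= 1.
Proof.
move=> /andP[q0 q4] Ed dq jd.
have : expR (j * d - 2 * q) <= expR (- (7 / 4 * q)) by rewrite ler_expR; lra.
have := expR_ge1Dx (7 / 4 * q); rewrite expRN; set F := expR (7 / 4 * q) => hF.
have F0 : 0 < F := expR_gt0 _.
(* Since [4 d <= q], the first summand [q * E] is at most [q + q ^ 2 / 2]. *)
suff : F^-1 <= 1 - q - q ^+ 2 / 2 by nra.
rewrite -[leLHS]mul1r ler_pdivrMr //.
have : 0 <= 1 - q - q ^+ 2 / 2 by nra.
nra.
Qed.
End Estimates.

(** * The product over a chain and the induction on the family *)

Lemma prod_cardD_le (R : realType) (K : choiceType) (n : nat) (delta : R)
    (A : {fset {fset K}}) (T : seq {fset K}) (U : {fset K}) :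
  (0 < n)%N -> nuniform n A -> {subset T <= A} ->
  \prod_(b <- T) (#|` (b `\` U)%fset|%:R / n%:R * expR delta) <=
  expR ((size T)%:R * delta - (\sum_(b <- T) #|` (b `&` U)%fset|)%:R / n%:R).
Proof.
move=> n0 uA; have nR : 0 < n%:R :> R by rewrite ltr0n.
have nR0 : n%:R != 0 :> R by rewrite gt_eqF.
elim: T => [|b T IH] TA; first by rewrite !big_nil /= !mul0r subrr expR0.
rewrite !big_cons /=.
have bA : b \in A by apply: TA; rewrite inE eqxx.
have /(congr1 (fun m => m%:R : R)) := cardfsID U b.
rewrite (uA _ bA) !natrD => E.
rewrite -natr1; set s := (\sum_(_ <- _) _)%:R.
have -> : ((size T)%:R + 1) * delta - (#|` (b `&` U)%fset|%:R + s) / n%:R =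
  (- (#|` (b `&` U)%fset|%:R / n%:R) + delta)
  + ((size T)%:R * delta - s / n%:R) :> R by ring.
rewrite !expRD; apply: ler_pM.
- by rewrite mulr_ge0 ?expR_ge0 // divr_ge0.
- by apply: prodr_ge0 => c _; rewrite mulr_ge0 ?expR_ge0 // divr_ge0.
(* With [t] the fraction of [b] lying in [U], this is [1 - t <= e^(-t)]. *)
- rewrite ler_pM2r ?expR_gt0 //; apply: le_trans (expR_ge1Dx _).
  by rewrite -mulNr ler_pdivrMr // mulrDl mul1r divfK //; lra.
- by rewrite -expRD; apply: IH => c cT; apply: TA; rewrite inE cT orbT.
Qed.

(** The bound [6 k ^ 2 <= n] leaves room to grow a chain, and [8 n delta <= k - 1] keeps the loss
    [e^delta] per deletion below the gain in both cases. *)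
Lemma cweight_le_tau_bound (R : realType) (K : choiceType) (n k : nat)
    (delta : R) (A : {fset {fset K}}) :
  (0 < k)%N -> (6 * k ^ 2 <= n)%N -> 0 <= delta ->
  8 * n%:R * delta <= k.-1%:R ->
  intersecting A -> nuniform n A -> cweight n n%:R A <= tau_bound n delta A.
Proof.
move=> k0 kn d0 dk; have n0 : (0 < n)%N by nia.
have nR : 0 < n%:R :> R by rewrite ltr0n.
have nR0 : n%:R != 0 :> R by rewrite gt_eqF.
elim/fproper_ind: A => A IH iA uA.
have bnd A' : (A' `<` A)%fset -> cweight n n%:R A' <= tau_bound n delta A'.
  move=> pA'; have sA' := fproper_sub pA'.
  by apply: IH; [| apply: intersecting_sub sA' iA | apply: nuniform_sub sA' uA].
(* Deletions may push [tau] below [n / 2]; there the bound is at least 1 and [cweight_le1]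
   suffices. *)
have [nt|tn] := leqP n (tau A).*2; last first.
  apply: le_trans (cweight_le1 R n0 uA) _.
  apply: le_trans (expR_ge1Dx _); rewrite lerDl -mulNr mulr_ge0 //.
  by move: tn; rewrite -(ltr_nat R) -muln2 natrM; lra.
have knR : 6 * k%:R ^+ 2 <= n%:R :> R by rewrite -natrX -natrM ler_nat.
have k1 : k.-1%:R = k%:R - 1 :> R by rewrite -subn1 natrB.
have kR1 : 1 <= k%:R :> R by rewrite ler1n.
pose mu : R := k%:R / n%:R.
have nmu : n%:R * mu = k%:R by rewrite /mu mulrC divfK // gt_eqF.
have mu0 : 0 < mu by rewrite divr_gt0 // ltr0n.
have mu6 : mu <= 1 / 6.
  by rewrite ler_pdivrMr //; nra.
have dmu : 8 * delta <= mu by nra.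
have E1 : 1 <= expR delta by rewrite -expR0 ler_expR.
have E2 : expR delta <= 1 + 2 * delta by apply: expR_le1D2x; lra.
have [[a [b [aA bA lo hi]]]|far] := pselect (exists a b : {fset K},
  [/\ a \in A, b \in A, k <= #|` a `&` b| & #|` a `&` b| <= n - k]%fset%N).
  pose U := (a `&` b)%fset.
  have card_diff c : c \in A -> (U `<=` c)%fset ->
      #|` (c `\` U)%fset|%:R / n%:R = 1 - #|` U|%:R / n%:R :> R.
    move=> cA Uc; rewrite cardfsDS // (uA _ cA) natrB; last first.
      by rewrite -(uA _ cA) fsubset_leq_card.
    by rewrite mulrBl divff // gt_eqF.
  apply: (@cweight_le_tau_bound_step R K n n0 delta d0 A a [:: b] U) => //.
  - by move=> c; rewrite !inE => /orP[]/eqP->.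
  - apply: fsubset_trans (fsubsetIl a b) _.
    by apply: (@bigfcup_sup _ _ _ a _ id).
  - by rewrite /= fsubset_refl.
  rewrite big_cons big_seq1 !card_diff ?fsubsetIl ?fsubsetIr //.
  have loR : k%:R <= #|` U|%:R :> R by rewrite ler_nat.
  have hiR : #|` U|%:R <= n%:R - k%:R :> R.
    rewrite -natrB ?ler_nat //; apply: leq_trans lo _.
    by rewrite -(uA _ aA) fsubset_leq_card ?fsubsetIl.
  (* The ratio [|U| / n] stays [mu] away from 0 and 1, and [8 delta <= mu] yields
     [e^delta <= 1 + mu / 4]. *)
  apply: (@pair_estimate R _ mu); [lra| |lra].
  rewrite /mu ler_pM2r ?invr_gt0 // loR /=.
  by rewrite ler_pdivrMr // mulrBl mul1r divfK.
have [|b [T [U [[TA UA pT sT] U4 kU]]]] := exists_overlap_chain iA uA k0 kn nt.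
  move=> a b aA bA; have [h|h] := ltnP #|` (a `&` b)%fset| k; first by left.
  right; rewrite ltnNge; apply/negP => h'; apply: far; exists a, b.
  by split.
apply: (@cweight_le_tau_bound_step R K n n0 delta d0 A b T U) => //.
apply: le_trans (lerD (lexx _) (prod_cardD_le delta U n0 uA TA)) _.
pose q : R := #|` U|%:R / n%:R.
have sq : 2 * q <= (\sum_(b0 <- b :: T) #|` (b0 `&` U)%fset|)%:R / n%:R.
  rewrite /q mulrA ler_pM2r ?invr_gt0 // -natrM ler_nat.
  by rewrite mul2n.
set J : R := (size (b :: T))%:R.
have J1 : 1 <= J by rewrite ler1n.
(* The stopping rule [(k - 1) J <= 2 |U|] meets [8 n delta <= k - 1]. *)
have jq : 4 * (J * delta) <= q.
  rewrite ler_pdivlMr //.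
  have : k.-1%:R * J <= 2 * #|` U|%:R.
    by rewrite -!natrM ler_nat mul2n.
  nra.
apply: (@le_trans _ _ (q * expR delta + expR (J * delta - 2 * q))).
  by rewrite lerD2l ler_expR lerD2l lerN2.
apply: (@chain_estimate R q delta J) => //; last by nra.
rewrite divr_ge0 //= ler_pdivrMr //.
by move: U4; rewrite -(ler_nat R) natrM; lra.
Qed.

(** * Choice of the parameters *)

Lemma natr_powR_eventually_ge (R : realType) (eps M : R) : 0 < eps -> 0 <= M ->
  exists n0 : nat, forall n : nat, (n0 < n)%N -> M <= n%:R `^ eps.
Proof.
move=> e0 M0; exists (Num.bound (M `^ eps^-1)) => n lt.
have Me : M = (M `^ eps^-1) `^ eps by rewrite -powRrM mulVf ?gt_eqF // powRr1.
rewrite [leLHS]Me; apply: ge0_ler_powR; rewrite ?nnegrE ?powR_ge0 ?(ltW e0) //.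
apply: le_trans (ltW (archi_boundP (powR_ge0 _ _))) _.
by rewrite ler_nat ltnW.
Qed.

Theorem theorem2 (R : realType) (eps : R) (heps : 0 < eps) :
  exists n0 : nat, forall n : nat, (n0 < n)%N ->
  forall (K : choiceType) (A : {fset {fset K}}),
    intersecting A -> nuniform n A -> n%:R / 2 <= (tau A)%:R :> R ->
    cweight n (n%:R : R) A
      <= expR (- (((tau A)%:R - n%:R / 2) * n%:R `^ (- (1 / 2) - eps))).
Proof.
have [n1 n1P] := natr_powR_eventually_ge heps (ler0n R 48).
(* The value 54 is [6 * 3 ^ 2] and forces [k >= 3]. Then [8 s <= 24 (k + 1) <= 48 (k - 1)] for [s]
   the square root of [n], so it is enough that [n ^ eps] is at least 48. *)
exists (maxn n1 54) => n; rewrite gtn_max => /andP[/n1P large n54] K A iA uA _.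
have nR : 0 < n%:R :> R by rewrite ltr0n; lia.
have nR0 : n%:R != 0 :> R by rewrite gt_eqF.
(* The largest admissible [k] is taken, so that [k] is of order [sqrt n] from below as well. *)
have [k kn nk] : exists2 k, (6 * k ^ 2 <= n)%N & (n < 6 * k.+1 ^ 2)%N.
  have ex0 : exists k, (6 * k ^ 2 <= n)%N by exists 0%N.
  have ub k : (6 * k ^ 2 <= n)%N -> (k <= n)%N by nia.
  case: (ex_maxnP ex0 ub) => k kn kmax; exists k => //.
  by rewrite ltnNge; apply/negP => /kmax; rewrite ltnn.
have k3 : (3 <= k)%N by nia.
apply: (@cweight_le_tau_bound R K n k); rewrite ?powR_ge0 //; first by lia.
pose s : R := n%:R `^ (1 / 2); pose e := n%:R `^ eps.
have s0 : 0 < s by apply: powR_gt0.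
have e0 : 0 < e by apply: powR_gt0.
have ss : s * s = n%:R.
  by rewrite -powRD ?nR0 ?implybT // -splitr powRr1 // ltW.
have -> : n%:R `^ (- (1 / 2) - eps) = s^-1 / e.
  by rewrite powRD ?nR0 ?implybT // !powRN.
have -> : 8 * n%:R * (s^-1 / e) = 8 * s / e.
  by rewrite -ss; field; rewrite !gt_eqF.
have k1 : k.-1%:R = k%:R - 1 :> R by rewrite -subn1 natrB //; lia.
have kR3 : 3 <= k%:R :> R by rewrite (ler_nat _ 3).
rewrite ler_pdivrMr // k1.
have sk : s <= 3 * (k%:R + 1).
  have : n%:R <= 6 * (k%:R + 1) ^+ 2 :> R.
    by rewrite natr1 -natrX -natrM ler_nat ltnW.
  rewrite -ss; nra.
move: large; rewrite -/e => large; nra.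
Qed.
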